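(* Let $I$ be a quasi prime and radical right ideal of $\mathbb{H}[q_1,\ldots,q_n]$ such that $\sqrt{\mathcal{S}(I)}$ is quasi prime. Then $\mathcal{V}_c(I)$ is irreducible.
   Context: $\mathbb{H}$ is the skew field of quaternions, $\mathbb{S}=\{J\in\mathbb{H}: J^2=-1\}$, and for $K\in\mathbb{S}$, $\mathbb{C}_K=\mathbb{R}+\mathbb{R}K$. $\mathbb{H}[q_1,\ldots,q_n]$ is the set of slice regular polynomials, i.e. functions $P:\mathbb{H}^n\to\mathbb{H}$, $P(q_1,\ldots,q_n)=\sum q_1^{\ell_1}\cdots q_n^{\ell_n}a_{\ell_1,\ldots,\ell_n}$ (finite sum, variables in this order, coefficients in $\mathbb{H}$ on the right). It is a ring under pointwise sum and the $*$-product determined by $(q^{\ell}a)*(q^{m}b)=q^{\ell+m}ab$ for multi-indices $\ell,m$, where $q^\ell=q_1^{\ell_1}\cdots q_n^{\ell_n}$. For a right ideal $I$, $\mathcal{V}(I)\subseteq\mathbb{H}^n$ is the set of common zeros of all $P\in I$, and $\mathcal{V}_c(I)=\mathcal{V}(I)\cap\bigcup_{K\in\mathbb{S}}\mathbb{C}_K^n$. The regular conjugate of $P=\sum q^\ell a_\ell$ is $P^c=\sum q^\ell\,\overline{a_\ell}$; the symmetrization of $P$ is $P^s=P*P^c=P^c*P$. The symmetrized ideal is $\mathcal{S}(I)=\langle P^s: P\in I\rangle$, the right ideal generated by the $P^s$. A right ideal $J$ is completely prime if, whenever $P*Q\in J$ and $P*J\subseteq J$, either $P\in J$ or $Q\in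 J$. The radical $\sqrt{I}$ of a right ideal $I$ is the intersection of all completely prime right ideals containing $I$; $I$ is radical if $\sqrt{I}=I$. A right ideal $I$ is quasi prime if, whenever $P*Q\in I$, either $P\in I$ or $Q^s\in I$. A set $\mathcal{V}_c(I)$ is reducible if there exist proper, non-trivial right ideals $I_1,I_2$ of $\mathbb{H}[q_1,\ldots,q_n]$ with $\mathcal{V}_c(I)=\mathcal{V}_c(I_1)\cup\mathcal{V}_c(I_2)$, where neither of $\mathcal{V}_c(I_1),\mathcal{V}_c(I_2)$ is contained in the other; otherwise it is irreducible. *)

(* Defs.v *)
From HB Require Import structures.
From mathcomp Require Import all_boot all_order all_algebra.
From mathcomp Require Import mpoly.
From mathcomp Require Import boolp classical_sets reals.
From mathcomp Require Import ring.

Set Implicit Arguments.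
Unset Strict Implicit.
Unset Printing Implicit Defensive.

Import GRing.Theory.

Local Open Scope classical_set_scope.
Local Open Scope ring_scope.

(* Quat a b c d is a + b i + c j + d k *)
Record quat (R : realType) := Quat { qre : R; qi : R; qj : R; qk : R }.

Definition quat_tuple (R : realType) (x : quat R) : R * R * R * R :=
  (qre x, qi x, qj x, qk x).

Definition tuple_quat (R : realType) (t : R * R * R * R) : quat R :=
  Quat t.1.1.1 t.1.1.2 t.1.2 t.2.

Lemma quat_tupleK (R : realType) : cancel (@quat_tuple R) (@tuple_quat R).
Proof. by case. Qed.

HB.instance Definition _ (R : realType) :=
  Choice.copy (quat R) (can_type (@quat_tupleK R)).

Definition qadd (R : realType) (x y : quat R) : quat R :=
  Quat (qre x + qre y) (qi x + qi y) (qj x + qj y) (qk x + qk y).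

Definition qopp (R : realType) (x : quat R) : quat R :=
  Quat (- qre x) (- qi x) (- qj x) (- qk x).

Definition qmul (R : realType) (x y : quat R) : quat R :=
  Quat (qre x * qre y - qi x * qi y - qj x * qj y - qk x * qk y)
       (qre x * qi y + qi x * qre y + qj x * qk y - qk x * qj y)
       (qre x * qj y - qi x * qk y + qj x * qre y + qk x * qi y)
       (qre x * qk y + qi x * qj y - qj x * qi y + qk x * qre y).

Definition qreal (R : realType) (a : R) : quat R := Quat a 0 0 0.

Definition qconj (R : realType) (x : quat R) : quat R :=
  Quat (qre x) (- qi x) (- qj x) (- qk x).

Section QuatRing.
Variable R : realType.
Implicit Types x y z : quat R.

Fact qaddA : associative (@qadd R).
Proof. by move=> [? ? ? ?] [? ? ? ?] [? ? ? ?]; rewrite /qadd /=; congr Quat; ring. Qed.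

Fact qaddC : commutative (@qadd R).
Proof. by move=> [? ? ? ?] [? ? ? ?]; rewrite /qadd /=; congr Quat; ring. Qed.

Fact qadd0 : left_id (qreal 0) (@qadd R).
Proof. by move=> [? ? ? ?]; rewrite /qadd /=; congr Quat; ring. Qed.

Fact qaddN : left_inverse (qreal 0) (@qopp R) (@qadd R).
Proof. by move=> [? ? ? ?]; rewrite /qadd /qreal /=; congr Quat; ring. Qed.

HB.instance Definition _ :=
  GRing.isZmodule.Build (quat R) qaddA qaddC qadd0 qaddN.

Fact qmulA : associative (@qmul R).
Proof. by move=> [? ? ? ?] [? ? ? ?] [? ? ? ?]; rewrite /qmul /=; congr Quat; ring. Qed.

Fact qmul1l : left_id (qreal 1) (@qmul R).
Proof. by move=> [? ? ? ?]; rewrite /qmul /=; congr Quat; ring. Qed.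

Fact qmul1r : right_id (qreal 1) (@qmul R).
Proof. by move=> [? ? ? ?]; rewrite /qmul /=; congr Quat; ring. Qed.

Fact qmulDl : left_distributive (@qmul R) (@qadd R).
Proof. by move=> [? ? ? ?] [? ? ? ?] [? ? ? ?]; rewrite /qmul /qadd /=; congr Quat; ring. Qed.

Fact qmulDr : right_distributive (@qmul R) (@qadd R).
Proof. by move=> [? ? ? ?] [? ? ? ?] [? ? ? ?]; rewrite /qmul /qadd /=; congr Quat; ring. Qed.

Fact qone_neq0 : qreal 1 != qreal 0 :> quat R.
Proof. by apply/eqP => -[] /eqP; rewrite oner_eq0. Qed.

HB.instance Definition _ :=
  GRing.Zmodule_isNzRing.Build (quat R) qmulA qmul1l qmul1r qmulDl qmulDr
    qone_neq0.

Fact qconj_is_zmod_morphism : zmod_morphism (@qconj R).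
Proof. by move=> [? ? ? ?] [? ? ? ?]; congr Quat; rewrite /=; ring. Qed.

HB.instance Definition _ :=
  GRing.isZmodMorphism.Build (quat R) (quat R) (@qconj R)
    qconj_is_zmod_morphism.

End QuatRing.

Definition imag_units (R : realType) : set (quat R) := [set J | J ^+ 2 = -1].

Definition slice (R : realType) (K : quat R) : set (quat R) :=
  [set z | exists a b : R, z = qreal a + qreal b * K].

(* The variables of {mpoly (quat R)[n]} commute with each other and with the
   coefficients, so its product is the *-product, and p@_m is the coefficient
   a_m of q^m a_m. *)

(* The library's meval puts the coefficients on the left of the monomials; the
   product over 'I_n is taken in increasing order of the index. *)
Definition sreval (R : realType) (n : nat) (P : {mpoly (quat R)[n]})
    (q : 'I_n -> quat R) : quat R :=
  \sum_(m <- msupp P) (\prod_(i < n) q i ^+ m i) * P@_m.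

Definition regular_conj (R : realType) (n : nat) (P : {mpoly (quat R)[n]}) :
    {mpoly (quat R)[n]} :=
  map_mpoly (@qconj R) P.

Definition symmetrization (R : realType) (n : nat) (P : {mpoly (quat R)[n]}) :
    {mpoly (quat R)[n]} :=
  P * regular_conj P.

Definition right_ideal (A : nzRingType) (I : set A) : Prop :=
  [/\ I 0, (forall x y, I x -> I y -> I (x + y))
         & (forall x a, I x -> I (x * a))].

Definition right_ideal_gen (A : nzRingType) (X : set A) : set A :=
  smallest (@right_ideal A) X.

Definition completely_prime (A : nzRingType) (J : set A) : Prop :=
  forall x y, J (x * y) -> (forall z, J z -> J (x * z)) -> J x \/ J y.

(* An intersection of such J, so in general not itself completely prime. *)
Definition radical (A : nzRingType) (I : set A) : set A :=
  smallest (fun J => right_ideal J /\ completely_prime J) I.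

Definition is_radical (A : nzRingType) (I : set A) : Prop := radical I = I.

Definition quasi_prime (R : realType) (n : nat)
    (I : set {mpoly (quat R)[n]}) : Prop :=
  forall P Q, I (P * Q) -> I P \/ I (symmetrization Q).

Definition symmetrized_ideal (R : realType) (n : nat)
    (I : set {mpoly (quat R)[n]}) : set {mpoly (quat R)[n]} :=
  right_ideal_gen [set symmetrization P | P in I].

Definition zero_locus (R : realType) (n : nat)
    (I : set {mpoly (quat R)[n]}) : set ('I_n -> quat R) :=
  [set q | forall P, I P -> sreval P q = 0].

Definition slice_points (R : realType) (n : nat) : set ('I_n -> quat R) :=
  \bigcup_(K in @imag_units R) [set q | forall i, slice K (q i)].

Definition zero_locus_c (R : realType) (n : nat)
    (I : set {mpoly (quat R)[n]}) : set ('I_n -> quat R) :=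
  zero_locus I `&` @slice_points R n.

Definition proper_nontrivial (A : nzRingType) (I : set A) : Prop :=
  I <> setT /\ I <> [set 0].

Definition reducible (R : realType) (n : nat)
    (V : set ('I_n -> quat R)) : Prop :=
  exists I1 I2 : set {mpoly (quat R)[n]},
    [/\ right_ideal I1 /\ proper_nontrivial I1,
        right_ideal I2 /\ proper_nontrivial I2,
        V = zero_locus_c I1 `|` zero_locus_c I2,
        ~ zero_locus_c I1 `<=` zero_locus_c I2
      & ~ zero_locus_c I2 `<=` zero_locus_c I1].

Definition irreducible (R : realType) (n : nat)
    (V : set ('I_n -> quat R)) : Prop := ~ reducible V.

(* Main.v *)
Require Import Defs.
From HB Require Import structures.
From mathcomp Require Import all_boot all_order all_algebra.
From mathcomp Require Import mpoly.
From mathcomp Require Import boolp classical_sets reals.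
From mathcomp Require Import complex ring lra zify.

(** Write V for the slice zero locus of I. A point of a slice is x + y K, where
    z = x + i y lies in C^n and K is an imaginary unit; the points with the same
    z form a sphere. Since i can be taken central, a polynomial P has on the
    sphere of z the form K |-> a + K b with two quaternions a, b (evre, evim)
    that do not depend on K. Hence P has no zero on a sphere, exactly one, or
    vanishes on all of it, and a polynomial with real coefficients vanishes
    at one point of a sphere iff it vanishes on the whole sphere.

    Geometry enters through a Nullstellensatz: a polynomial that vanishes on V
    lies in I as soon as I is radical (radical_nullstellensatz). It suffices to
    treat a completely prime right ideal J. The real polynomials in J form a
    prime ideal p of R[x_1, ..., x_n], and over every complex zero z of p the
    ideal J has a common zero on the sphere of z (contraction_zero). If some N
    in J has a trace f = N + N^c outside p, then f P = N P + N^c P, where N^c P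
    vanishes on all spheres over zeros of p because N and P vanish at a common
    point of each; so the components of N^c P are in p by the commutative
    Nullstellensatz, f P is in J, and complete primality gives P in J. If
    all traces are in p, then J vanishes on entire spheres, so P does too, and
    its components are in p.

    The commutative Nullstellensatz for prime ideals (nullstellensatz_prime) is
    proved by adjoining one variable at a time: a zero over which a suitable
    polynomial u does not vanish extends to the next variable.

    Now let V be the union of V1 and V2, the loci of I1 and I2, neither inside
    the other. If P1 in I1 is not in I and Q is in I2, then P1 * Q^s vanishes
    on V, and quasi primality gives Q^s in I; thus each Q in I2 has a zero
    on every sphere that meets V, and therefore I2 has a common zero there.
    By symmetry the same holds for I1. Consequently, on a sphere that meets V,
    either V1 and V2 are the same single point, or one of them is the whole
    sphere. Choose real components f1, f2 of elements of I1, I2 that do not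
    vanish identically on V. For P in I1, the product P f1 f2 vanishes on V in
    all cases, so it is in I; quasi primality cancels the real factors f1 and
    f2, so P is in I. Hence I1 is contained in I and V in V1, a
    contradiction. *)

Set Implicit Arguments.
Unset Strict Implicit.
Unset Printing Implicit Defensive.

Import GRing.Theory Num.Theory.

Local Open Scope classical_set_scope.
Local Open Scope ring_scope.

(** * Right ideals and prime ideals *)

Definition prime_ideal (A : comNzRingType) (p : set A) : Prop :=
  [/\ right_ideal p, ~ p 1 & forall x y, p (x * y) -> p x \/ p y].

Section RightIdealTheory.
Variables (A : nzRingType) (I : set A).
Hypothesis idI : right_ideal I.

Lemma right_idealMr x a : I x -> I (x * a).
Proof. by case: idI => _ _; apply. Qed.

Lemma right_idealD x y : I x -> I y -> I (x + y).
Proof. by case: idI => _ + _; apply. Qed.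

Lemma right_idealN x : I x -> I (- x).
Proof. by move=> Ix; rewrite -mulrN1; apply: right_idealMr. Qed.

Lemma right_idealB x y : I x -> I y -> I (x - y).
Proof. by move=> Ix Iy; apply: right_idealD => //; apply: right_idealN. Qed.

Lemma right_ideal_sum (T : Type) (r : seq T) (Q : pred T) (F : T -> A) :
  (forall i, Q i -> I (F i)) -> I (\sum_(i <- r | Q i) F i).
Proof. by move=> IF; elim/big_ind: _ => //; [case: idI|apply: right_idealD]. Qed.

End RightIdealTheory.

Section PrimeIdealTheory.
Variables (A : comNzRingType) (p : set A).
Hypothesis prp : prime_ideal p.

Lemma prime_idealX x k : p (x ^+ k) -> p x.
Proof.
have [_ np1 pM] := prp; elim: k => [|k IHk]; first by rewrite expr0 => /np1.
by rewrite exprS => /pM [].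
Qed.

Lemma prime_idealNM x y : ~ p x -> ~ p y -> ~ p (x * y).
Proof. by have [_ _ pM] := prp => npx npy /pM []. Qed.

Lemma prime_ideal_preim (B : comNzRingType) (f : {rmorphism B -> A}) :
  prime_ideal (f @^-1` p).
Proof.
have [idp np1 pM] := prp; split; rewrite /preimage /=.
- split=> [|x y px py|x a px] /=.
  + by rewrite rmorph0; case: idp.
  + by rewrite rmorphD; apply: right_idealD.
  + by rewrite rmorphM; apply: right_idealMr.
- by rewrite rmorph1.
- by move=> x y; rewrite rmorphM => /pM.
Qed.

End PrimeIdealTheory.

(** * Extending a specialization by one variable *)

Section OneStepExtension.
Variables (A : comNzRingType) (p : set {poly A}).
Hypothesis prp : prime_ideal p.

Let p0 : set A := polyC @^-1` p.

Let prp0 : prime_ideal p0. Proof. exact: prime_ideal_preim. Qed.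

Let idp : right_ideal p. Proof. by case: prp. Qed.
Let idp0 : right_ideal p0. Proof. by case: prp0. Qed.

(** The ideal p contains the extension of its contraction p0; so modulo p only
    the coefficients outside p0 matter. *)
Lemma coef_contraction_mem (g : {poly A}) : (forall i, p0 g`_i) -> p g.
Proof.
move=> g0; rewrite -[g]coefK poly_def; apply: right_ideal_sum => // i _.
by rewrite -mul_polyC; apply: right_idealMr => //; apply: g0.
Qed.

(** Dropping the leading terms whose coefficients are in p0 turns a polynomial
    into one with leading coefficient outside p0. This replaces
    the passage to the domain A / p0. *)
Lemma truncate_mod (g : {poly A}) i : ~ p0 g`_i ->
  exists2 g', ~ p0 (lead_coef g') /\ (size g' <= size g)%N
    & forall j, p0 (g - g')`_j.
Proof.
move=> gi.
have bnd j : `[< ~ p0 g`_j >] -> (j <= size g)%N.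
  move=> /asboolP gj; rewrite leqNgt; apply/negP => /ltnW lt_j.
  by apply: gj; rewrite nth_default //; case: idp0.
have ex : exists j, `[< ~ p0 g`_j >] by exists i; apply/asboolP.
case: (ex_maxnP ex bnd) => d /asboolP gd maxd.
have tail j : (d < j)%N -> p0 g`_j.
  by rewrite ltnNge => /negP lt_dj; apply: contrapT => gj;
     apply/lt_dj/maxd/asboolP.
have nz : (take_poly d.+1 g)`_d != 0.
  rewrite coef_take_poly ltnSn; apply/eqP => g0.
  by apply: gd; rewrite g0; case: idp0.
have sz : size (take_poly d.+1 g) = d.+1.
  apply/eqP; rewrite eqn_leq size_take_poly /= ltnNge.
  by apply/negP => le; case/eqP: nz; rewrite nth_default.
exists (take_poly d.+1 g).
  rewrite lead_coefE sz /= coef_take_poly ltnSn; split=> //.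
  by rewrite ltnNge; apply/negP => le; apply: gd; rewrite nth_default //; case: idp0.
move=> j; rewrite coefB coef_take_poly; case: ltnP => dj.
  by rewrite subrr; case: idp0.
by rewrite subr0; apply: tail.
Qed.

Let generic (g : {poly A}) : Prop := exists i, ~ p0 g`_i.

Let genericPn g : ~ p g -> generic g.
Proof.
by move=> ng; apply: contrapT => /forallNP g0; apply/ng/coef_contraction_mem => i;
   apply: contrapT; apply: g0.
Qed.

Let contraction_coefM (g h : {poly A}) :
  (forall i, p0 g`_i) -> forall i, p0 (g * h)`_i.
Proof.
move=> g0 i; rewrite coefM; apply: right_ideal_sum => // j _.
exact: right_idealMr.
Qed.

Let lead_neq0 (g : {poly A}) : ~ p0 (lead_coef g) -> g != 0.
Proof.
move=> g0; apply/eqP => gE; apply: g0; rewrite gE lead_coef0.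
by case: idp0.
Qed.

(** Over the fraction field of A / p0 this is a minimal polynomial, up to a
    scalar, of the class of 'X modulo p. *)
Definition minimal_relation (m : {poly A}) : Prop :=
  [/\ p m, ~ p0 (lead_coef m)
     & forall g, p g -> (size g < size m)%N -> forall i, p0 g`_i].

Lemma exists_minimal_relation m :
  p m -> generic m -> exists m', minimal_relation m'.
Proof.
elim: {m}(size m) {-2}m (leqnn (size m)) => [|n IHn] m sm pm [i mi].
  by case: mi; rewrite nth_default ?(leq_trans sm) //; case: idp0.
have [m' [lm' sm'] dm'] := truncate_mod mi.
have pm' : p m'.
  by rewrite -[m'](subKr m); apply: right_idealB => //; apply: coef_contraction_mem.
have [[g [pg sg [j gj]]]|noex] :=
    pselect (exists g, [/\ p g, (size g < size m')%N & generic g]).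
  apply: (IHn g) => //; last by exists j.
  by rewrite -ltnS (leq_trans sg) // (leq_trans sm').
exists m'; split=> // g pg sg j; apply: contrapT => gj.
by apply: noex; exists g; split=> //; exists j.
Qed.

Section MinimalRelation.
Variable m : {poly A}.
Hypothesis minm : minimal_relation m.

Lemma size_minimal_relation : (1 < size m)%N.
Proof.
have [pm lm _] := minm; rewrite ltnNge; apply/negP => /size1_polyC mE.
by apply: lm; rewrite mE lead_coefC /p0 /preimage /= -mE.
Qed.

(** The pseudo-division remainder of g by m is in p and too short to be
    nonzero modulo p0, so m divides g up to a power of its leading coefficient. *)
Lemma lead_minimal_relation g : p g -> exists k h,
  forall i, p0 (lead_coef m ^+ k *: g - h * m)`_i.
Proof.
move=> pg; have [pm lm small] := minm.
exists (Pdiv.Ring.rscalp g m), (Pdiv.Ring.rdivp g m).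
rewrite Pdiv.ComRing.rdivp_eq addrAC subrr add0r; apply: small.
  have -> : Pdiv.Ring.rmodp g m = lead_coef m ^+ Pdiv.Ring.rscalp g m *: g
             - Pdiv.Ring.rdivp g m * m
    by rewrite Pdiv.ComRing.rdivp_eq addrAC subrr add0r.
  by apply: right_idealB => //; [rewrite -mul_polyC mulrC|rewrite mulrC];
     apply: right_idealMr.
by rewrite Pdiv.Ring.ltn_rmodp lead_neq0.
Qed.

(** Irreducibility of m: a factorization of a multiple of m as h * v modulo p0,
    with v outside p and of size at least 2, would put in p the factor h,
    which is shorter than m modulo p0. *)
Lemma quotient_notin_small v k h r : ~ p0 (lead_coef v) -> (1 < size v)%N ->
  lead_coef v ^+ k *: m = h * v + r -> (size r < size v)%N ->
  (size r < size m)%N -> p r -> ~ p v -> False.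
Proof.
move=> lv sv E sr srm pr npv; have [pm lm small] := minm.
have [_ _ pM] := prp.
have r0 : forall i, p0 r`_i by apply: small.
have ph : p h.
  have : p (h * v).
    have -> : h * v = lead_coef v ^+ k *: m - r by rewrite E addrK.
    by apply: right_idealB => //; rewrite -mul_polyC mulrC; apply: right_idealMr.
  by case/pM.
(* If h were zero modulo p0, the leading coefficient of m would be in p0. *)
have [h0|] := pselect (forall i, p0 h`_i).
  have : p0 (lead_coef v ^+ k * lead_coef m).
    rewrite lead_coefE -coefZ E coefD; apply: right_idealD => //.
    exact: contraction_coefM.
  by apply: prime_idealNM => // /(prime_idealX prp0).
move=> /existsNP [i hi]; have [h' [lh' _] dh'] := truncate_mod hi.
have ph' : p h'.
  by rewrite -[h'](subKr h); apply: right_idealB => //; apply: coef_contraction_mem.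
have sh' : (size m <= size h')%N.
  by rewrite leqNgt; apply/negP => /(small _ ph') /(_ (size h').-1).
(* The leading coefficient of h' * v lies outside p0, but its index is at least
   the size of m, where all coefficients of the other side are in p0. *)
apply: (@prime_idealNM _ _ prp0 _ _ lh' lv); rewrite mul_lead_coef.
have -> : h' * v = lead_coef v ^+ k *: m - (r + (h - h') * v) by rewrite E; ring.
rewrite coefB coefZ (@nth_default _ _ m) ?mulr0 ?sub0r; last by lia.
apply: right_idealN => //; rewrite coefD; apply: right_idealD => //.
exact: contraction_coefM.
Qed.

(** Every v outside p is invertible modulo p after inverting an element of A
    outside p0. The Euclidean algorithm on m and v shortens v until it is
    a constant; it never stops at a remainder in p by the previous lemma. *)
Lemma bezout_minimal_relation (v : {poly A}) : (size v < size m)%N -> ~ p v ->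
  exists s u, ~ p0 u /\ p (s * v - u%:P).
Proof.
have [n] := ubnP (size v); elim: n v => // n IHn v svn svm npv.
have [i vi] := genericPn npv; have [w [lw sw] dw] := truncate_mod vi.
have pdw : p (v - w) by apply: coef_contraction_mem.
have [/size1_polyC wE|w1] := leqP (size w) 1.
  exists 1, (lead_coef w); rewrite mul1r; split=> //.
  by rewrite wE lead_coefC -wE.
have npw : ~ p w by move=> pw; apply: npv; rewrite -[v](subrK w); apply: right_idealD.
set k := Pdiv.Ring.rscalp m w; set h := Pdiv.Ring.rdivp m w.
set r := Pdiv.Ring.rmodp m w.
have E : lead_coef w ^+ k *: m = h * w + r := Pdiv.ComRing.rdivp_eq w m.
have sr : (size r < size w)%N by rewrite Pdiv.Ring.ltn_rmodp lead_neq0.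
have [pr|npr] := pselect (p r).
  have srm := ltn_trans sr (leq_ltn_trans sw svm).
  by case: (quotient_notin_small lw w1 E sr srm pr npw).
have [||s [u [u0 psu]]] := IHn r _ _ npr.
- exact: leq_trans sr (leq_trans sw svn).
- exact: ltn_trans sr (leq_ltn_trans sw svm).
exists (- s * h), u; split=> //.
have -> : - s * h * v - u%:P = (s * r - u%:P) - (lead_coef w ^+ k *: m * s)
     - (v - w) * (s * h) by rewrite E; ring.
have [pm _ _] := minm.
apply: (right_idealB idp); last exact: right_idealMr.
apply: (right_idealB idp) => //; apply: (right_idealMr idp).
by rewrite -mul_polyC mulrC; apply: right_idealMr.
Qed.

Lemma bezout_prime (v : {poly A}) : ~ p v -> exists s u, ~ p0 u /\ p (s * v - u%:P).
Proof.
move=> npv; have [pm lm _] := minm.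
set k := Pdiv.Ring.rscalp v m; set h := Pdiv.Ring.rdivp v m.
set r := Pdiv.Ring.rmodp v m.
have E : lead_coef m ^+ k *: v = h * m + r := Pdiv.ComRing.rdivp_eq m v.
have sr : (size r < size m)%N by rewrite Pdiv.Ring.ltn_rmodp lead_neq0.
have npr : ~ p r.
  move=> pr; have : p ((lead_coef m ^+ k)%:P * v).
    by rewrite mul_polyC E; apply: right_idealD => //; rewrite mulrC; apply: right_idealMr.
  by apply: prime_idealNM => // /(prime_idealX prp0).
have [s [u [u0 psu]]] := bezout_minimal_relation sr npr.
exists (s * (lead_coef m ^+ k)%:P), u; split=> //.
rewrite -mulrA mul_polyC E mulrDr -addrA; apply: right_idealD => //.
by rewrite mulrA mulrC; apply: right_idealMr.
Qed.

End MinimalRelation.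

(** If p contains a genuine relation, the extended value x is a root of the
    image of a minimal relation m, which keeps its degree because the leading
    coefficient of m divides u; Bezout then protects v. If it contains none, any
    x outside the roots of the image of v works. *)
Lemma extend_specialization (K : closedFieldType) (v : {poly A}) : ~ p v ->
  exists2 u, ~ p0 u & forall phi : {rmorphism A -> K},
    (forall a, p0 a -> phi a = 0) -> phi u != 0 ->
    exists2 x, forall g, p g -> (map_poly phi g).[x] = 0
             & (map_poly phi v).[x] != 0.
Proof.
move=> npv; have [[g [pg gg]]|nogen] := pselect (exists g, p g /\ generic g).
  have [m minm] := exists_minimal_relation pg gg.
  have [pm lm _] := minm.
  have [s [u [u0 psu]]] := bezout_prime minm npv.
  exists (lead_coef m * u); first exact: prime_idealNM.
  move=> phi phi0; rewrite rmorphM mulf_eq0 negb_or => /andP[phim phiu].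
  have : size (map_poly phi m) != 1%N.
    rewrite size_poly_eq // neq_ltn size_minimal_relation ?orbT //.
  move=> /closed_rootP [x /rootP mx].
  have vanish h : p h -> (map_poly phi h).[x] = 0.
    move=> /(lead_minimal_relation minm) [k [q E]].
    have : map_poly phi (lead_coef m ^+ k *: h - q * m) = 0.
      by apply/polyP => i; rewrite coef_map /= phi0 // coef0.
    rewrite rmorphB rmorphM /= map_polyZ /= => /(congr1 (horner^~ x)).
    rewrite hornerD hornerN hornerM hornerZ mx mulr0 subr0 horner0 rmorphXn.
    by move/eqP; rewrite mulf_eq0 expf_eq0 (negbTE phim) andbF /= => /eqP.
  exists x => //; apply: contra_neq phiu => vx.
  have := vanish _ psu; rewrite rmorphB rmorphM /= map_polyC hornerD hornerM.
  by rewrite vx mulr0 add0r hornerN hornerC => /eqP; rewrite oppr_eq0 => /eqP.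
have [i vi] := genericPn npv; exists v`_i => // phi phi0 phiv.
have /closed_nonrootP [x nrx] : map_poly phi v != 0.
  by apply: contra_neq phiv => v0; rewrite -coef_map v0 coef0.
exists x => // h ph; suff -> : map_poly phi h = 0 by rewrite horner0.
apply/polyP => j; rewrite coef_map coef0 /= phi0 //; apply: contrapT => hj.
by apply: nogen; exists h; split=> //; exists j.
Qed.

End OneStepExtension.

(** * The commutative Nullstellensatz for prime ideals *)

Lemma mpoly_rmorph_ext (n : nat) (k : nzRingType) (S : nzRingType)
    (f g : {rmorphism {mpoly k[n]} -> S}) :
  (forall c, f c%:MP = g c%:MP) -> (forall i, f 'X_i = g 'X_i) -> f =1 g.
Proof.
move=> fgC fgX q; rewrite [q]mpolyE !rmorph_sum; apply: eq_bigr => m _.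
rewrite -mul_mpolyC !rmorphM /= fgC mpolyXE_id !rmorph_prod; congr (_ * _).
by apply: eq_bigr => i _; rewrite !rmorphXn /= fgX.
Qed.

Section AdjoinVariable.
Variables (n : nat) (k : comNzRingType).

Definition shift_vars : {mpoly k[n]} -> {mpoly k[n.+1]} :=
  mmap (@mpolyC _ _) (fun i => 'X_(lift ord0 i)).
HB.instance Definition _ := GRing.RMorphism.on shift_vars.

Definition eval_first_var : {poly {mpoly k[n]}} -> {mpoly k[n.+1]} :=
  horner_eval ('X_ord0) \o map_poly shift_vars.
HB.instance Definition _ := GRing.RMorphism.on eval_first_var.

Definition split_first_var : {mpoly k[n.+1]} -> {poly {mpoly k[n]}} :=
  mmap (polyC \o @mpolyC _ _)
    (fun i => if unlift ord0 i is Some j then ('X_j)%:P else 'X).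
HB.instance Definition _ := GRing.RMorphism.on split_first_var.

Lemma split_first_varK : cancel split_first_var eval_first_var.
Proof.
apply: (mpoly_rmorph_ext (f := eval_first_var \o split_first_var) (g := idfun)).
  move=> c; rewrite /= /split_first_var mmapC /eval_first_var /= map_polyC.
  by rewrite /horner_eval hornerC /= /shift_vars mmapC.
move=> i; rewrite /= /split_first_var mmapX mmap1U /eval_first_var /=.
case: unliftP => [j|] ->; rewrite ?map_polyC ?map_polyX /horner_eval;
  rewrite ?hornerC ?hornerX //=.
by rewrite /shift_vars mmapX mmap1U.
Qed.

End AdjoinVariable.

Lemma mmap_eval_first_var (n : nat) (k K : comNzRingType)
    (iota : {rmorphism k -> K}) (z : 'I_n -> K) (x : K) (g : {poly {mpoly k[n]}}) :
  mmap iota (oapp z x \o unlift ord0) (eval_first_var g)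
  = (map_poly (mmap iota z) g).[x].
Proof.
set w := _ \o _.
have wS h : mmap iota w (shift_vars h) = mmap iota z h.
  apply: (mpoly_rmorph_ext (f := mmap iota w \o @shift_vars n k)
                           (g := mmap iota z)).
    by move=> c; rewrite /= /shift_vars !mmapC.
  by move=> i; rewrite /= /shift_vars !mmapX !mmap1U mmapX mmap1U /w /= liftK.
rewrite /eval_first_var /= /horner_eval -[in RHS](coefK g) -[in LHS](coefK g).
rewrite !poly_def !rmorph_sum !horner_sum rmorph_sum; apply: eq_bigr => i _.
rewrite -!mul_polyC !rmorphM /= !map_polyC !map_polyXn !hornerM !hornerC.
by rewrite !hornerXn !rmorphM /= wS rmorphXn /= mmapX mmap1U /w /= unlift_none.
Qed.

(** Induction on the number of variables: contracting p to the remaining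
    variables gives a zero avoiding the polynomial u of the one-step
    extension, which is then extended to the first variable. *)
Theorem nullstellensatz_prime (k : fieldType) (K : closedFieldType)
    (iota : {rmorphism k -> K}) (n : nat) (p : set {mpoly k[n]}) v :
  prime_ideal p -> ~ p v ->
  exists2 z : 'I_n -> K, forall g, p g -> mmap iota z g = 0
                       & mmap iota z v != 0.
Proof.
elim: n p v => [|n IHn] p v prp npv.
  have [idp np1 _] := prp; exists (fun=> 0); last first.
    rewrite (nvar0_mpolyC v) mmapC fmorph_eq0; apply: contra_notN npv => /eqP v0.
    by rewrite (nvar0_mpolyC v) v0 mpolyC0; case: idp.
  move=> g; rewrite (nvar0_mpolyC g); move: (g@_0%MM) => c pc.
  rewrite mmapC; have [->|c0] := eqVneq c 0; first exact: rmorph0.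
  by case: np1; rewrite -mpolyC1 -(mulfV c0) mpolyCM; apply: right_idealMr.
pose q := @eval_first_var n k @^-1` p.
have prq : prime_ideal q by exact: prime_ideal_preim.
have nqv : ~ q (split_first_var v) by rewrite /q /preimage /= split_first_varK.
have [u nqu ext] := extend_specialization prq K nqv.
have [z z0 zu] := IHn _ _ (prime_ideal_preim prq polyC) nqu.
have [x x0 xv] := ext (mmap iota z) z0 zu.
exists (oapp z x \o unlift ord0) => [g pg|].
  rewrite -[g]split_first_varK mmap_eval_first_var x0 //.
  by rewrite /q /preimage /= split_first_varK.
by rewrite -[v]split_first_varK mmap_eval_first_var.
Qed.

(** * The algebra of quaternions *)

Section Quaternions.
Variable R : realType.
Implicit Types x y K : quat R.

Lemma quat_eq x y : qre x = qre y -> qi x = qi y -> qj x = qj y ->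
  qk x = qk y -> x = y.
Proof. by case: x y => ? ? ? ? [? ? ? ?] /= -> -> -> ->. Qed.

Fact qre_is_zmod_morphism : zmod_morphism (@qre R). Proof. by []. Qed.
HB.instance Definition _ := GRing.isZmodMorphism.Build (quat R) R (@qre R)
  qre_is_zmod_morphism.
Fact qi_is_zmod_morphism : zmod_morphism (@qi R). Proof. by []. Qed.
HB.instance Definition _ := GRing.isZmodMorphism.Build (quat R) R (@qi R)
  qi_is_zmod_morphism.
Fact qj_is_zmod_morphism : zmod_morphism (@qj R). Proof. by []. Qed.
HB.instance Definition _ := GRing.isZmodMorphism.Build (quat R) R (@qj R)
  qj_is_zmod_morphism.
Fact qk_is_zmod_morphism : zmod_morphism (@qk R). Proof. by []. Qed.
HB.instance Definition _ := GRing.isZmodMorphism.Build (quat R) R (@qk R)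
  qk_is_zmod_morphism.

Lemma qreM x y : qre (x * y) =
  qre x * qre y - qi x * qi y - qj x * qj y - qk x * qk y.
Proof. by []. Qed.
Lemma qiM x y : qi (x * y) =
  qre x * qi y + qi x * qre y + qj x * qk y - qk x * qj y.
Proof. by []. Qed.
Lemma qjM x y : qj (x * y) =
  qre x * qj y - qi x * qk y + qj x * qre y + qk x * qi y.
Proof. by []. Qed.
Lemma qkM x y : qk (x * y) =
  qre x * qk y + qi x * qj y - qj x * qi y + qk x * qre y.
Proof. by []. Qed.

Definition quatE := (raddfD, raddfB, raddfN, qreM, qiM, qjM, qkM).

Fact qreal_is_zmod_morphism : zmod_morphism (@qreal R).
Proof. by move=> a b; apply: quat_eq; rewrite raddfB /= ?subrr. Qed.
HB.instance Definition _ := GRing.isZmodMorphism.Build R (quat R) (@qreal R)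
  qreal_is_zmod_morphism.
Fact qreal_is_monoid_morphism : monoid_morphism (@qreal R).
Proof. by split=> // a b; apply: quat_eq; rewrite ?quatE /=; ring. Qed.
HB.instance Definition _ := GRing.isMonoidMorphism.Build R (quat R) (@qreal R)
  qreal_is_monoid_morphism.

Lemma qrealC a x : qreal a * x = x * qreal a.
Proof. by apply: quat_eq; rewrite ?quatE /=; ring. Qed.

Definition qnorm2 x : R := qre x ^+ 2 + qi x ^+ 2 + qj x ^+ 2 + qk x ^+ 2.

Lemma mul_qconj x : x * qconj x = qreal (qnorm2 x).
Proof. by apply: quat_eq; rewrite ?quatE /qnorm2 /=; ring. Qed.

Lemma mul_conjq x : qconj x * x = qreal (qnorm2 x).
Proof. by apply: quat_eq; rewrite ?quatE /qnorm2 /=; ring. Qed.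

Lemma qconjM x y : qconj (x * y) = qconj y * qconj x.
Proof. by apply: quat_eq; rewrite ?quatE /=; ring. Qed.

Lemma qconjK : involutive (@qconj R).
Proof. by case=> a b c d; rewrite /qconj /= !opprK. Qed.

Lemma qnorm2M x y : qnorm2 (x * y) = qnorm2 x * qnorm2 y.
Proof. by rewrite /qnorm2 !quatE; ring. Qed.

Lemma qnorm2_eq0 x : qnorm2 x = 0 -> x = 0.
Proof.
move=> /eqP; rewrite /qnorm2 !paddr_eq0 ?addr_ge0 ?sqr_ge0 // !sqrf_eq0.
by case/andP => /andP[/andP[/eqP a /eqP b] /eqP c] /eqP d; apply: quat_eq.
Qed.

Definition qinv x := qreal (qnorm2 x)^-1 * qconj x.

Lemma mulq_inv x : x <> 0 -> x * qinv x = 1.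
Proof.
move=> x0; have nx : qnorm2 x != 0 by apply/eqP => /qnorm2_eq0.
by rewrite /qinv qrealC mulrA mul_qconj -rmorphM mulfV.
Qed.

Lemma mulq_eq0 x y : x * y = 0 -> x = 0 \/ y = 0.
Proof.
move=> xy0; have [->|x0] := pselect (x = 0); [by left|right].
have : qinv x * (x * y) = 0 by rewrite xy0 mulr0.
rewrite mulrA /qinv -[_ * _ * x]mulrA mul_conjq -rmorphM mulVf ?mul1r //.
by apply/eqP => /qnorm2_eq0.
Qed.

(** If K ^ 2 = -1 then the vector part of K ^ 2, which is twice the real part of
    K times its vector part, is zero; were the real part nonzero, K would be real
    and its square nonnegative. *)
Lemma imag_unitP K : imag_units K <-> qre K = 0 /\ qnorm2 K = 1.
Proof.
have -> : imag_units K = (K * K = -1) by rewrite -expr2.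
split; last first.
  case=> K0 K1; apply: quat_eq; rewrite ?quatE /= K0; [|ring..].
  by move: K1; rewrite /qnorm2 K0 => <-; ring.
move=> KK.
have E0 : qre K * qre K - qi K * qi K - qj K * qj K - qk K * qk K = -1.
  by rewrite -qreM KK.
have E1 : 0 = qi (K * K) by rewrite KK raddfN /= oppr0.
have E2 : 0 = qj (K * K) by rewrite KK raddfN /= oppr0.
have E3 : 0 = qk (K * K) by rewrite KK raddfN /= oppr0.
have K0 : qre K = 0.
  apply/eqP; apply: contraT => K0.
  have half t : 0 = 2 * (qre K * t) -> t = 0.
    by move/esym/eqP; rewrite !mulf_eq0 pnatr_eq0 (negbTE K0) /= => /eqP.
  have Ki : qi K = 0 by apply: half; rewrite E1 qiM; ring.
  have Kj : qj K = 0 by apply: half; rewrite E2 qjM; ring.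
  have Kk : qk K = 0 by apply: half; rewrite E3 qkM; ring.
  by move: E0; rewrite Ki Kj Kk; have := sqr_ge0 (qre K); nra.
by split=> //; rewrite /qnorm2 K0; move: E0; rewrite K0; nra.
Qed.

Lemma imag_unit_conj K : imag_units K -> qconj K = - K.
Proof. by case/imag_unitP => K0 _; apply: quat_eq; rewrite ?quatE /= ?K0 ?oppr0. Qed.

Lemma imag_unit_sqr K : imag_units K -> K * K = -1.
Proof. by rewrite -expr2. Qed.

End Quaternions.

(** * Evaluation of quaternionic polynomials on a sphere *)

(** The evaluation and component maps are locked so that unification never
    compares their unfolded bodies, which are large finite sums. *)
HB.lock Definition ceval (R : realType) (n : nat) (z : 'I_n -> R[i])
  (f : {mpoly R[n]}) : R[i] := mmap (real_complex R) z f.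

HB.lock Definition comp (R : realType) (n : nat)
  (phi : {additive quat R -> R}) (P : {mpoly (quat R)[n]}) : {mpoly R[n]} :=
  map_mpoly phi P.

HB.lock Definition real_mpoly (R : realType) (n : nat) (f : {mpoly R[n]}) :
  {mpoly (quat R)[n]} := map_mpoly (@qreal R) f.

Section LockedMorphisms.
Variables (R : realType) (n : nat).

Fact ceval_is_zmod_morphism (z : 'I_n -> R[i]) : zmod_morphism (ceval z).
Proof. by move=> f g; rewrite !ceval.unlock raddfB. Qed.
HB.instance Definition _ z := GRing.isZmodMorphism.Build {mpoly R[n]} R[i]
  (ceval z) (ceval_is_zmod_morphism z).
Fact ceval_is_monoid_morphism (z : 'I_n -> R[i]) : monoid_morphism (ceval z).
Proof. by split=> [|f g]; rewrite !ceval.unlock ?rmorph1 ?rmorphM. Qed.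
HB.instance Definition _ z := GRing.isMonoidMorphism.Build {mpoly R[n]} R[i]
  (ceval z) (ceval_is_monoid_morphism z).

Fact comp_is_zmod_morphism (phi : {additive quat R -> R}) :
  zmod_morphism (@comp R n phi).
Proof. by move=> P Q; rewrite !comp.unlock raddfB. Qed.
HB.instance Definition _ phi := GRing.isZmodMorphism.Build
  {mpoly (quat R)[n]} {mpoly R[n]} (@comp R n phi) (comp_is_zmod_morphism phi).

Fact real_mpoly_is_zmod_morphism : zmod_morphism (@real_mpoly R n).
Proof. by move=> f g; rewrite !real_mpoly.unlock raddfB. Qed.
HB.instance Definition _ := GRing.isZmodMorphism.Build
  {mpoly R[n]} {mpoly (quat R)[n]} (@real_mpoly R n) real_mpoly_is_zmod_morphism.
Fact real_mpoly_is_monoid_morphism : monoid_morphism (@real_mpoly R n).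
Proof. by split=> [|f g]; rewrite !real_mpoly.unlock ?rmorph1 ?rmorphM. Qed.
HB.instance Definition _ := GRing.isMonoidMorphism.Build
  {mpoly R[n]} {mpoly (quat R)[n]} (@real_mpoly R n) real_mpoly_is_monoid_morphism.

End LockedMorphisms.

Notation compre := (comp (@qre _)).
Notation compi := (comp (@qi _)).
Notation compj := (comp (@qj _)).
Notation compk := (comp (@qk _)).

Section SphereEvaluation.
Variables (R : realType) (n : nat).
Implicit Types (P Q : {mpoly (quat R)[n]}) (f : {mpoly R[n]}).
Implicit Types (z : 'I_n -> R[i]) (K : quat R).

Lemma mcoeff_comp (phi : {additive quat R -> R}) P m : (comp phi P)@_m = phi P@_m.
Proof. by rewrite comp.unlock mcoeff_map_mpoly. Qed.
Lemma mcoeff_real_mpoly f m : (real_mpoly f)@_m = qreal f@_m.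
Proof. by rewrite real_mpoly.unlock mcoeff_map_mpoly. Qed.
Lemma mcoeff_regular_conj P m : (regular_conj P)@_m = qconj P@_m.
Proof. exact: mcoeff_map_mpoly. Qed.
Definition comp_coefE := (mcoeff_comp, mcoeff_real_mpoly, mcoeff_regular_conj).

Lemma cevalC z c : ceval z c%:MP = (c%:C)%C.
Proof. by rewrite ceval.unlock mmapC. Qed.

Lemma ceval_comp z P (phi : {additive quat R -> R}) :
  ceval z (comp phi P)
  = \sum_(m <- msupp P) (phi P@_m)%:C%C * mmap1 z m.
Proof.
rewrite comp.unlock {1}/map_mpoly {1}/mmap rmorph_sum; apply: eq_bigr => m _.
by rewrite rmorphM /= cevalC mmap1_id ceval.unlock mmapX.
Qed.

Lemma compC (phi : {additive quat R -> R}) (c : quat R) :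
  comp phi c%:MP_[n] = (phi c)%:MP.
Proof. by rewrite comp.unlock map_mpolyC. Qed.

Lemma compreM P Q : compre (P * Q) =
  compre P * compre Q - compi P * compi Q - compj P * compj Q - compk P * compk Q.
Proof.
apply/mpolyP => m; rewrite !mcoeffB comp_coefE !mcoeffM raddf_sum -!sumrB.
by apply: eq_bigr => i _; rewrite /= !comp_coefE.
Qed.

Lemma compiM P Q : compi (P * Q) =
  compre P * compi Q + compi P * compre Q + compj P * compk Q - compk P * compj Q.
Proof.
apply/mpolyP => m; rewrite !(mcoeffB, mcoeffD) comp_coefE !mcoeffM raddf_sum.
rewrite -!big_split -!sumrB.
by apply: eq_bigr => i _; rewrite /= !comp_coefE.
Qed.

Lemma compjM P Q : compj (P * Q) =
  compre P * compj Q - compi P * compk Q + compj P * compre Q + compk P * compi Q.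
Proof.
apply/mpolyP => m; rewrite !(mcoeffB, mcoeffD) comp_coefE !mcoeffM raddf_sum.
rewrite -!(big_split, sumrB).
by apply: eq_bigr => i _; rewrite /= !comp_coefE.
Qed.

Lemma compkM P Q : compk (P * Q) =
  compre P * compk Q + compi P * compj Q - compj P * compi Q + compk P * compre Q.
Proof.
apply/mpolyP => m; rewrite !(mcoeffB, mcoeffD) comp_coefE !mcoeffM raddf_sum.
rewrite -!(big_split, sumrB).
by apply: eq_bigr => i _; rewrite /= !comp_coefE.
Qed.

(** With i a central square root of -1, P (z) = evre z P + i * evim z P in the
    complexified quaternions. This is why the two maps multiply like real and
    imaginary parts. *)
Definition evre z P : quat R :=
  Quat (complex.Re (ceval z (compre P))) (complex.Re (ceval z (compi P)))
       (complex.Re (ceval z (compj P))) (complex.Re (ceval z (compk P))).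

Definition evim z P : quat R :=
  Quat (complex.Im (ceval z (compre P))) (complex.Im (ceval z (compi P)))
       (complex.Im (ceval z (compj P))) (complex.Im (ceval z (compk P))).

Let ReB (a b : R[i]) : complex.Re (a - b) = complex.Re a - complex.Re b.
Proof. by case: a b => ? ? []. Qed.
Let ImB (a b : R[i]) : complex.Im (a - b) = complex.Im a - complex.Im b.
Proof. by case: a b => ? ? []. Qed.
Let ReD (a b : R[i]) : complex.Re (a + b) = complex.Re a + complex.Re b.
Proof. by case: a b => ? ? []. Qed.
Let ImD (a b : R[i]) : complex.Im (a + b) = complex.Im a + complex.Im b.
Proof. by case: a b => ? ? []. Qed.
Let ReM (a b : R[i]) : complex.Re (a * b)
  = complex.Re a * complex.Re b - complex.Im a * complex.Im b.
Proof. by case: a b => ? ? []. Qed.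
Let ImM (a b : R[i]) : complex.Im (a * b)
  = complex.Re a * complex.Im b + complex.Im a * complex.Re b.
Proof. by case: a b => ? ? [] ? ?. Qed.

Lemma evreB z P Q : evre z (P - Q) = evre z P - evre z Q.
Proof. by apply: quat_eq; rewrite ?raddfB /= raddfB /= rmorphB ReB. Qed.
Lemma evimB z P Q : evim z (P - Q) = evim z P - evim z Q.
Proof. by apply: quat_eq; rewrite ?raddfB /= raddfB /= rmorphB ImB. Qed.

Lemma evreD z P Q : evre z (P + Q) = evre z P + evre z Q.
Proof. by apply: quat_eq; rewrite ?raddfD /= raddfD /= rmorphD ReD. Qed.
Lemma evimD z P Q : evim z (P + Q) = evim z P + evim z Q.
Proof. by apply: quat_eq; rewrite ?raddfD /= raddfD /= rmorphD ImD. Qed.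

Let cevalM z P Q : [/\
  ceval z (compre (P * Q)) = ceval z (compre P) * ceval z (compre Q)
    - ceval z (compi P) * ceval z (compi Q)
    - ceval z (compj P) * ceval z (compj Q)
    - ceval z (compk P) * ceval z (compk Q),
  ceval z (compi (P * Q)) = ceval z (compre P) * ceval z (compi Q)
    + ceval z (compi P) * ceval z (compre Q)
    + ceval z (compj P) * ceval z (compk Q)
    - ceval z (compk P) * ceval z (compj Q),
  ceval z (compj (P * Q)) = ceval z (compre P) * ceval z (compj Q)
    - ceval z (compi P) * ceval z (compk Q)
    + ceval z (compj P) * ceval z (compre Q)
    + ceval z (compk P) * ceval z (compi Q)
& ceval z (compk (P * Q)) = ceval z (compre P) * ceval z (compk Q)
    + ceval z (compi P) * ceval z (compj Q)
    - ceval z (compj P) * ceval z (compi Q)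
    + ceval z (compk P) * ceval z (compre Q)].
Proof.
rewrite compreM compiM compjM compkM.
by split; rewrite ?(rmorphB, rmorphD) /= !rmorphM.
Qed.

Lemma evreM z P Q :
  evre z (P * Q) = evre z P * evre z Q - evim z P * evim z Q.
Proof.
have [E0 E1 E2 E3] := cevalM z P Q; rewrite /evre /evim E0 E1 E2 E3.
case: (ceval z (compre P)) (ceval z (compi P)) (ceval z (compj P))
  (ceval z (compk P)) => ? ? [? ?] [? ?] [? ?].
case: (ceval z (compre Q)) (ceval z (compi Q)) (ceval z (compj Q))
  (ceval z (compk Q)) => ? ? [? ?] [? ?] [? ?].
by apply: quat_eq => /=; ring.
Qed.

Lemma evimM z P Q :
  evim z (P * Q) = evre z P * evim z Q + evim z P * evre z Q.
Proof.
have [E0 E1 E2 E3] := cevalM z P Q; rewrite /evre /evim E0 E1 E2 E3.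
case: (ceval z (compre P)) (ceval z (compi P)) (ceval z (compj P))
  (ceval z (compk P)) => ? ? [? ?] [? ?] [? ?].
case: (ceval z (compre Q)) (ceval z (compi Q)) (ceval z (compj Q))
  (ceval z (compk Q)) => ? ? [? ?] [? ?] [? ?].
by apply: quat_eq => /=; ring.
Qed.

Lemma evreC z (c : quat R) : evre z c%:MP = c.
Proof.
rewrite /evre !compC !cevalC.
by apply: quat_eq.
Qed.

Lemma evimC z (c : quat R) : evim z c%:MP = 0.
Proof.
rewrite /evim !compC !cevalC.
by apply: quat_eq.
Qed.

Let comp_conj P : [/\ compre (regular_conj P) = compre P,
  compi (regular_conj P) = - compi P, compj (regular_conj P) = - compj P
  & compk (regular_conj P) = - compk P].
Proof. by split; apply/mpolyP => m; rewrite ?mcoeffN !comp_coefE. Qed.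

Lemma evre_conj z P : evre z (regular_conj P) = qconj (evre z P).
Proof.
have [E0 E1 E2 E3] := comp_conj P; rewrite /evre E0 E1 E2 E3 !rmorphN.
by apply: quat_eq => //=; rewrite -sub0r ReB sub0r.
Qed.

Lemma evim_conj z P : evim z (regular_conj P) = qconj (evim z P).
Proof.
have [E0 E1 E2 E3] := comp_conj P; rewrite /evim E0 E1 E2 E3 !rmorphN.
by apply: quat_eq => //=; rewrite -sub0r ImB sub0r.
Qed.

Let comp_real f : [/\ compre (real_mpoly f) = f, compi (real_mpoly f) = 0,
  compj (real_mpoly f) = 0 & compk (real_mpoly f) = 0].
Proof. by split; apply/mpolyP => m; rewrite ?mcoeff0 !comp_coefE. Qed.

Lemma evre_real z f : evre z (real_mpoly f) = qreal (complex.Re (ceval z f)).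
Proof.
by have [E0 E1 E2 E3] := comp_real f; rewrite /evre E0 E1 E2 E3 rmorph0.
Qed.

Lemma evim_real z f : evim z (real_mpoly f) = qreal (complex.Im (ceval z f)).
Proof.
by have [E0 E1 E2 E3] := comp_real f; rewrite /evim E0 E1 E2 E3 rmorph0.
Qed.

Lemma real_mpolyC f P : real_mpoly f * P = P * real_mpoly f.
Proof.
apply/mpolyP => m; rewrite mcoeffM mcoeffMr; apply: eq_bigr => i _.
by rewrite comp_coefE qrealC.
Qed.

Lemma regular_conjK P : regular_conj (regular_conj P) = P.
Proof. by apply/mpolyP => m; rewrite !comp_coefE qconjK. Qed.

Lemma regular_conjM P Q :
  regular_conj (P * Q) = regular_conj Q * regular_conj P.
Proof.
apply/mpolyP => m; rewrite comp_coefE mcoeffM mcoeffMr raddf_sum.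
by apply: eq_bigr => i _; rewrite /= !comp_coefE qconjM.
Qed.

Lemma regular_conj_fixed P : regular_conj P = P -> P = real_mpoly (compre P).
Proof.
move=> PE; apply/mpolyP => m; rewrite !comp_coefE.
have : qconj P@_m = P@_m by rewrite -[in RHS]PE comp_coefE.
case: (P@_m) => a b c d [bE cE dE]; apply: quat_eq => //=.
- by move: bE; lra.
- by move: cE; lra.
- by move: dE; lra.
Qed.

Lemma symmetrization_real P :
  symmetrization P = real_mpoly (compre (symmetrization P)).
Proof.
by apply: regular_conj_fixed; rewrite regular_conjM regular_conjK.
Qed.

Lemma symmetrization_real_mpoly f :
  symmetrization (real_mpoly f) = real_mpoly (f * f).
Proof.
rewrite rmorphM /symmetrization; congr (_ * _); apply/mpolyP => m.
by rewrite !comp_coefE; apply: quat_eq => //=; rewrite oppr0.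
Qed.

Definition slice_point z K : 'I_n -> quat R :=
  fun i => qreal (complex.Re (z i)) + qreal (complex.Im (z i)) * K.

(** Sending i to K identifies the complex numbers with the slice of K; being
    multiplicative, it maps a monomial in z to the same monomial in the slice
    point, which is what relates sreval to the central evaluation. *)
Let embed K (c : R[i]) : quat R :=
  qreal (complex.Re c) + qreal (complex.Im c) * K.

Let embedM K : imag_units K -> {morph embed K : a b / a * b >-> a * b}.
Proof.
move=> SK a b; rewrite /embed ReM ImM rmorphB rmorphD !rmorphM /=.
set r := qreal _; set s := qreal (complex.Re b); set t := qreal (complex.Im a).
set u := qreal (complex.Im b).
have Ku : K * u = u * K by rewrite qrealC.
have Ks : K * s = s * K by rewrite qrealC.
rewrite [RHS]mulrDl !mulrDr [LHS]addrC mulrDl !mulrA.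
rewrite -[t * K * s]mulrA Ks -[t * K * u]mulrA Ku.
rewrite !mulrA -[_ * K * K]mulrA (imag_unit_sqr SK) mulrN1.
by rewrite addrACA [r * s + _]addrC.
Qed.

Let evre_sum z P : evre z P =
  \sum_(m <- msupp P) qreal (complex.Re (mmap1 z m)) * P@_m.
Proof.
have Rsum (F : _ -> R[i]) : complex.Re (\sum_(m <- msupp P) F m)
    = \sum_(m <- msupp P) complex.Re (F m) by apply: (big_morph _ ReD).
by apply: quat_eq; rewrite /= ceval_comp Rsum raddf_sum; apply: eq_bigr => m _;
   rewrite ?quatE ReM /=; ring.
Qed.

Let evim_sum z P : evim z P =
  \sum_(m <- msupp P) qreal (complex.Im (mmap1 z m)) * P@_m.
Proof.
have Isum (F : _ -> R[i]) : complex.Im (\sum_(m <- msupp P) F m)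
    = \sum_(m <- msupp P) complex.Im (F m) by apply: (big_morph _ ImD).
by apply: quat_eq; rewrite /= ceval_comp Isum raddf_sum; apply: eq_bigr => m _;
   rewrite ?quatE ImM /=; ring.
Qed.

Lemma sreval_point z K P : imag_units K ->
  sreval P (slice_point z K) = evre z P + K * evim z P.
Proof.
move=> SK; rewrite evre_sum evim_sum mulr_sumr -big_split /=.
apply: eq_bigr => m _; rewrite mulrA -qrealC -mulrDl; congr (_ * _).
have e1 : embed K 1 = 1 by rewrite /embed /= rmorph0 mul0r addr0.
rewrite -[RHS]/(embed K (mmap1 z m)) /mmap1 (big_morph _ (embedM SK) e1).
apply: eq_bigr => i _; rewrite -[slice_point z K i]/(embed K (z i)).
by elim: (m i) => [|k IHk]; rewrite ?expr0 ?e1 // !exprS IHk embedM.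
Qed.

Lemma slice_pointsP (q : 'I_n -> quat R) :
  slice_points q <-> exists z K, imag_units K /\ q = slice_point z K.
Proof.
split=> [[K SK sq]|[z [K [SK ->]]]]; last first.
  by exists K => // i; exists (complex.Re (z i)), (complex.Im (z i)).
have /choice [a] := sq => /choice [b] E.
exists (fun i => Complex (a i) (b i)), K; split=> //.
by apply/funext.
Qed.

End SphereEvaluation.

(** * Zeros on a sphere *)

Section Spheres.
Variables (R : realType) (n : nat).
Implicit Types (P Q : {mpoly (quat R)[n]}) (f : {mpoly R[n]}).
Implicit Types (z : 'I_n -> R[i]) (K : quat R) (J : set {mpoly (quat R)[n]}).

(** For an imaginary unit K, this is the vanishing of sreval P at the slice
    point of z and K, by sreval_point. *)
Definition vanishes_at z K P : Prop := evre z P + K * evim z P = 0.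

Definition vanishes_on_sphere z P : Prop := evre z P = 0 /\ evim z P = 0.

(** If a = - K b, then evaluating P * Q at K gives
    - K b a' - b b' + K (- K b b' + b a'), which cancels as K ^ 2 = -1. So the
    polynomials vanishing at one slice point form a right ideal. *)
Lemma vanishes_atM z K P Q :
  imag_units K -> vanishes_at z K P -> vanishes_at z K (P * Q).
Proof.
rewrite /vanishes_at evreM evimM => /imag_unit_sqr KK /eqP.
rewrite addr_eq0 => /eqP ->.
rewrite !mulNr mulrDr mulrN !mulrA KK mulN1r mulNr opprK.
by rewrite -opprD [_ * _ + K * _ * _]addrC addNr.
Qed.

Lemma vanishes_on_sphere_at z K P :
  vanishes_on_sphere z P -> vanishes_at z K P.
Proof. by case=> a0 b0; rewrite /vanishes_at a0 b0 mulr0 addr0. Qed.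

Lemma vanishes_at_two z K K' P : K <> K' ->
  vanishes_at z K P -> vanishes_at z K' P -> vanishes_on_sphere z P.
Proof.
move=> KK' vK vK'; have : (K - K') * evim z P = 0.
  have -> : (K - K') * evim z P = (evre z P + K * evim z P)
      - (evre z P + K' * evim z P) by rewrite mulrBl opprD addrACA subrr add0r.
  by rewrite vK vK' subrr.
case/mulq_eq0 => [/eqP|b0]; first by rewrite subr_eq0 => /eqP.
by move: vK; rewrite /vanishes_at /vanishes_on_sphere b0 mulr0 addr0.
Qed.

(** The values a, b of f on the sphere are real here, and K is not, so
    a + K b = 0 forces a = b = 0. *)
Lemma vanishes_at_real z K f : imag_units K ->
  vanishes_at z K (real_mpoly f) <-> ceval z f = 0.
Proof.
move=> SK; rewrite /vanishes_at evre_real evim_real; split; last first.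
  by move=> ->; rewrite /= !rmorph0 mulr0 addr0.
move=> E; apply/eqP; rewrite eq_complex /=.
have [K0 _] := (imag_unitP K).1 SK.
have Re0 : complex.Re (ceval z f) = 0.
  have := congr1 (@qre R) E; rewrite ?quatE /= K0.
  by rewrite !(mul0r, mulr0, subr0, addr0).
move: E; rewrite Re0 rmorph0 add0r eqxx /= => /mulq_eq0 [KE|].
  have := imag_unit_sqr SK; rewrite KE mulr0 => /eqP.
  by rewrite eq_sym oppr_eq0 oner_eq0.
by move=> /(congr1 (@qre R)) /= ->.
Qed.

Lemma real_vanishes_on_sphere z f :
  ceval z f = 0 -> vanishes_on_sphere z (real_mpoly f).
Proof.
by rewrite /vanishes_on_sphere evre_real evim_real => ->; rewrite /= rmorph0.
Qed.

Lemma vanishes_on_sphere_comp z P : vanishes_on_sphere z P <->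
  [/\ ceval z (compre P) = 0, ceval z (compi P) = 0, ceval z (compj P) = 0
    & ceval z (compk P) = 0].
Proof.
split=> [[[a0 a1 a2 a3] [b0 b1 b2 b3]]|[E0 E1 E2 E3]].
  by split; apply/eqP; rewrite eq_complex ?(a0,a1,a2,a3) ?(b0,b1,b2,b3) !eqxx.
by rewrite /vanishes_on_sphere /evre /evim E0 E1 E2 E3.
Qed.

Definition quat_i : quat R := Quat 0 1 0 0.
Definition quat_j : quat R := Quat 0 0 1 0.
Definition quat_k : quat R := Quat 0 0 0 1.

Lemma imag_unit_ijk :
  [/\ imag_units quat_i, imag_units quat_j & imag_units quat_k].
Proof. by split; apply/imag_unitP; rewrite /qnorm2 /=; split=> //; ring. Qed.

Lemma mpoly_compE P : P = real_mpoly (compre P)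
  + real_mpoly (compi P) * quat_i%:MP + real_mpoly (compj P) * quat_j%:MP
  + real_mpoly (compk P) * quat_k%:MP.
Proof.
apply/mpolyP => m; rewrite !mcoeffD !real_mpolyC !mcoeffCM !comp_coefE.
by apply: quat_eq; rewrite ?quatE /=; ring.
Qed.

(** The real and imaginary values of P^s are |a|^2 - |b|^2 and twice the real
    part of a times the conjugate of b. If both vanish and b is nonzero, then
    - a / b is an imaginary unit, and it is the zero of a + K b. *)
Lemma vanishes_symmetrization z P :
  vanishes_on_sphere z (symmetrization P) ->
  exists2 K, imag_units K & vanishes_at z K P.
Proof.
rewrite /vanishes_on_sphere /symmetrization evreM evimM evre_conj evim_conj.
set a := evre z P; set b := evim z P.
move=> [/eqP + E]; rewrite !mul_qconj subr_eq0 => /eqP [abE].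
have [b0|b0] := pselect (b = 0).
  have [Si _ _] := imag_unit_ijk; exists quat_i => //.
  rewrite /vanishes_at -/a -/b b0 mulr0 addr0; apply: qnorm2_eq0.
  by rewrite abE b0 /qnorm2 /= !expr0n !addr0.
have nb : qnorm2 b != 0 by apply/eqP => /qnorm2_eq0.
exists (- (a * qinv b)); last first.
  rewrite /vanishes_at -/a -/b mulNr -mulrA /qinv -[_ * _ * b]mulrA mul_conjq.
  by rewrite -rmorphM mulVf ?mulr1 ?subrr.
have -> : a * qinv b = qreal (qnorm2 b)^-1 * (a * qconj b).
  by rewrite /qinv mulrA -qrealC mulrA.
have re0 : qre (a * qconj b) = 0.
  have /= := congr1 (@qre R) E; lra.
have qre_real t x : qre (qreal t * x) = t * qre x by rewrite qreM /=; ring.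
have qreN x : qre (- x) = - qre x by [].
apply/imag_unitP; split; first by rewrite qreN qre_real re0 mulr0 oppr0.
have -> x : qnorm2 (- x) = qnorm2 x by rewrite /qnorm2 /= !sqrrN.
rewrite !qnorm2M abE; have -> x : qnorm2 (qconj x) = qnorm2 x.
  by rewrite /qnorm2 /= !sqrrN.
by rewrite /qnorm2 /= -/(qnorm2 b) !expr0n !addr0 mulrA expr2 mulfVK ?mulVf.
Qed.

(** Suppose P and Q in J have distinct single zeros K and L on the sphere.
    Divided on the right by their values of evim they become X - K and X - L as
    functions of the unit X, and their difference, an element of J, is the
    nonzero constant L - K without zeros. *)
Lemma common_zero_on_sphere z J : right_ideal J ->
  (forall P, J P -> exists2 K, imag_units K & vanishes_at z K P) ->
  exists2 K, imag_units K & forall P, J P -> vanishes_at z K P.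
Proof.
move=> idJ zeroJ.
have [[P [JP bP]]|noP] := pselect (exists P, J P /\ evim z P <> 0); last first.
  have [Si _ _] := imag_unit_ijk; exists quat_i => // P JP.
  have bP : evim z P = 0 by apply: contrapT => bP; apply: noP; exists P.
  have [K _] := zeroJ P JP.
  by rewrite /vanishes_at bP !mulr0.
have [K SK PK] := zeroJ P JP; exists K => // Q JQ.
have [L SL QL] := zeroJ Q JQ.
have [<- //|KL] := pselect (L = K).
have [bQ|bQ] := pselect (evim z Q = 0).
  by move: QL; rewrite /vanishes_at bQ !mulr0.
pose T := P * (qinv (evim z P))%:MP - Q * (qinv (evim z Q))%:MP.
have norm S M : vanishes_at z M S -> evim z S <> 0 ->
    evre z (S * (qinv (evim z S))%:MP) = - M /\
    evim z (S * (qinv (evim z S))%:MP) = 1.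
  rewrite /vanishes_at => /eqP; rewrite addr_eq0 => /eqP a0 b0.
  rewrite evreM evimM evreC evimC !mulr0 subr0 add0r a0.
  by rewrite mulNr -mulrA !mulq_inv ?mulr1.
have JT : J T by apply: right_idealB => //; apply: right_idealMr.
have [M _] := zeroJ T JT.
have [aP1 bP1] := norm _ _ PK bP; have [aQ1 bQ1] := norm _ _ QL bQ.
rewrite /vanishes_at evreB evimB aP1 bP1 aQ1 bQ1 subrr mulr0 addr0 opprK.
by move/eqP; rewrite addrC subr_eq0 => /eqP.
Qed.

End Spheres.

(** * The Nullstellensatz for right ideals *)

Section QuaternionicNullstellensatz.
Variables (R : realType) (n : nat).
Implicit Types (P Q : {mpoly (quat R)[n]}) (f : {mpoly R[n]}).
Implicit Types (z : 'I_n -> R[i]) (K : quat R) (J : set {mpoly (quat R)[n]}).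

Definition common_zero J z K : Prop :=
  imag_units K /\ forall P, J P -> vanishes_at z K P.

Lemma zero_locus_cP J (q : 'I_n -> quat R) :
  zero_locus_c J q <-> exists z K, q = slice_point z K /\ common_zero J z K.
Proof.
split=> [[Jq /slice_pointsP [z [K [SK qE]]]]|[z [K [-> [SK JzK]]]]].
  exists z, K; split=> //; split=> // P JP.
  by have := Jq P JP; rewrite qE sreval_point.
split; first by move=> P /JzK; rewrite /= sreval_point.
by apply/slice_pointsP; exists z, K.
Qed.

Lemma zero_locus_c_point J z K : imag_units K ->
  zero_locus_c J (slice_point z K) <-> common_zero J z K.
Proof.
move=> SK; split=> [[Jq _]|JzK]; last by apply/zero_locus_cP; exists z, K.
by split=> // P /Jq; rewrite sreval_point.
Qed.

(** Real polynomials are central, so multiplication by them preserves J and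
    complete primality applies to them. *)
Lemma prime_real_contraction J : right_ideal J -> completely_prime J -> ~ J 1 ->
  prime_ideal (@real_mpoly R n @^-1` J).
Proof.
move=> idJ cpJ nJ1; split; rewrite /preimage /=.
- split=> [|f g Jf Jg|f g Jf] /=.
  + by rewrite rmorph0; case: idJ.
  + by rewrite rmorphD; apply: right_idealD.
  + by rewrite rmorphM; apply: right_idealMr.
- by rewrite rmorph1.
- move=> f g; rewrite rmorphM => /cpJ; apply=> Q JQ.
  by rewrite real_mpolyC; apply: right_idealMr.
Qed.

Section Contraction.
Variable J : set {mpoly (quat R)[n]}.
Hypotheses (idJ : right_ideal J) (cpJ : completely_prime J) (nJ1 : ~ J 1).

Let p : set {mpoly R[n]} := @real_mpoly R n @^-1` J.

(** For P in J the symmetrization P^s is a real polynomial in J, so it vanishes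
    at z and P has a zero on the sphere. *)
Lemma contraction_zero z :
  (forall f, p f -> ceval z f = 0) -> exists K, common_zero J z K.
Proof.
move=> pz; have [P JP|K SK JK] := common_zero_on_sphere (z := z) idJ.
  apply: vanishes_symmetrization; rewrite symmetrization_real.
  apply/real_vanishes_on_sphere/pz; rewrite /p /preimage /=.
  by rewrite -symmetrization_real; apply: right_idealMr.
by exists K.
Qed.

(** The four real components of P vanish at the zeros of p, hence are in p by the
    commutative Nullstellensatz, and P is their combination with units 1, i, j, k. *)
Lemma mem_of_vanishing_on_spheres P :
  (forall z, (forall f, p f -> ceval z f = 0) -> vanishes_on_sphere z P) -> J P.
Proof.
move=> Pz; have prp : prime_ideal p by exact: prime_real_contraction.
have mem f : (forall z, (forall g, p g -> ceval z g = 0) -> ceval z f = 0) -> p f.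
  move=> fz; apply: contrapT => npf.
  have [z pz] := nullstellensatz_prime (real_complex R) prp npf.
  by case/eqP; have := fz z; rewrite ceval.unlock; apply=> g /pz.
rewrite [P]mpoly_compE;
  do 3?[apply: right_idealD => //; last apply: right_idealMr => //];
  by apply: mem => z /Pz /vanishes_on_sphere_comp [].
Qed.

End Contraction.

(** In the complexified quaternions, which are 2 x 2 complex matrices, P and Q
    take values in the same right ideal generated by a rank one idempotent e,
    and regular conjugation is the adjugate, which sends e to 1 - e; the
    product is zero as (1 - e) e = 0. *)
Lemma mul_conj_vanishes z K P Q : imag_units K ->
  vanishes_at z K P -> vanishes_at z K Q ->
  vanishes_on_sphere z (regular_conj P * Q).
Proof.
rewrite /vanishes_at /vanishes_on_sphere => SK.
move=> /eqP; rewrite addr_eq0 => /eqP aP /eqP; rewrite addr_eq0 => /eqP aQ.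
rewrite evreM evimM evre_conj evim_conj aP aQ raddfN /= qconjM (imag_unit_conj SK).
rewrite !(mulrN, mulNr, opprK) -!mulrA [K * (K * _)]mulrA (imag_unit_sqr SK).
by rewrite mulN1r !mulrN opprK subrr subrr.
Qed.

Lemma real_trace P :
  P + regular_conj P = real_mpoly (compre (P + regular_conj P)).
Proof.
apply: regular_conj_fixed; apply/mpolyP => m.
rewrite mcoeff_regular_conj mcoeffD mcoeff_regular_conj.
by apply: quat_eq; rewrite /= ?opprD ?opprK // addrC.
Qed.

(** The trace f = N + N^c of some N in J decides the case. If f is not in J,
    then N is generically of rank one and f P = N P + N^c P is in J.
    If all traces are in J, those of N * c for constants c make N vanish on
    entire spheres. *)
Lemma completely_prime_nullstellensatz J P :
  right_ideal J -> completely_prime J ->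
  (forall z K, common_zero J z K -> vanishes_at z K P) -> J P.
Proof.
move=> idJ cpJ JP; have [J1|nJ1] := pselect (J 1).
  by rewrite -[P]mul1r; apply: right_idealMr.
have [[N [JN nJt]]|trJ] := pselect (exists N, J N /\ ~ J (N + regular_conj N)).
  pose f := compre (N + regular_conj N).
  have tE : N + regular_conj N = real_mpoly f := real_trace N.
  have : J (real_mpoly f * P).
    rewrite -tE mulrDl; apply: right_idealD => //; first exact: right_idealMr.
    apply: mem_of_vanishing_on_spheres => // z /(contraction_zero idJ) [K zK].
    by have [SK zJ] := zK; apply: mul_conj_vanishes (JP _ _ zK); last apply: zJ.
  rewrite tE in nJt; case/cpJ => // Q JQ.
  by rewrite real_mpolyC; apply: right_idealMr.
apply: mem_of_vanishing_on_spheres => // z pz.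
have sphere Q : J Q -> vanishes_on_sphere z Q.
  have tr S : J S -> exists2 f, S + regular_conj S = real_mpoly f & ceval z f = 0.
    move=> JS; exists (compre (S + regular_conj S)); last first.
      apply: pz; rewrite /preimage /= -real_trace.
      by apply: contrapT => nJ; apply: trJ; exists S.
    exact: real_trace.
  (* The trace of S only controls the real parts; multiplying Q by the conjugate
     of one of its values turns its norm into such a real part. *)
  have re0 S : J S -> qre (evre z S) = 0 /\ qre (evim z S) = 0.
    move=> /tr [f E fz]; have /real_vanishes_on_sphere := fz.
    rewrite /vanishes_on_sphere -E evreD evimD evre_conj evim_conj => -[].
    by move=> /(congr1 (@qre R)) /= a0 /(congr1 (@qre R)) /= b0; split; lra.
  move=> JQ; split; apply: qnorm2_eq0.
    have /re0 [] : J (Q * (qconj (evre z Q))%:MP) by apply: right_idealMr.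
    by rewrite evreM evreC evimC mulr0 subr0 mul_qconj.
  have /re0 [_] : J (Q * (qconj (evim z Q))%:MP) by apply: right_idealMr.
  by rewrite evimM evreC evimC mulr0 add0r mul_qconj.
have [Si Sj _] := imag_unit_ijk R.
apply: (@vanishes_at_two _ _ _ (quat_i R) (quat_j R)).
- by case=> /eqP; rewrite oner_eq0.
- by apply: JP; split=> // Q /sphere; apply: vanishes_on_sphere_at.
- by apply: JP; split=> // Q /sphere; apply: vanishes_on_sphere_at.
Qed.

(** J is the intersection of the completely prime right ideals containing it, and
    the zeros of each of these are zeros of J. *)
Lemma radical_nullstellensatz J P : is_radical J ->
  (forall z K, common_zero J z K -> vanishes_at z K P) -> J P.
Proof.
move=> radJ JP; rewrite -radJ => M [[idM cpM] JM].
apply: completely_prime_nullstellensatz => // z K [SK MK].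
by apply: JP; split=> // Q /JM /MK.
Qed.

End QuaternionicNullstellensatz.

(** * Irreducibility *)

Section Irreducibility.
Variables (R : realType) (n : nat).
Implicit Types (P Q : {mpoly (quat R)[n]}) (f : {mpoly R[n]}).
Implicit Types (z : 'I_n -> R[i]) (K : quat R).
Implicit Types (I : set {mpoly (quat R)[n]}).

(** The three units i, j, k are distributed over two loci, so one locus contains
    two points of the sphere and hence the sphere. *)
Lemma sphere_pigeonhole z I1 I2 :
  (forall K, imag_units K -> common_zero I1 z K \/ common_zero I2 z K) ->
  (forall P, I1 P -> vanishes_on_sphere z P) \/
  (forall P, I2 P -> vanishes_on_sphere z P).
Proof.
have two I K L : K <> L -> common_zero I z K -> common_zero I z L ->
    forall P, I P -> vanishes_on_sphere z P.
  by move=> KL [_ IK] [_ IL] P IP; apply: vanishes_at_two KL (IK _ IP) (IL _ IP).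
have [Si Sj Sk] := imag_unit_ijk R => cov.
have ij : quat_i R <> quat_j R by case=> /eqP; rewrite oner_eq0.
have ik : quat_i R <> quat_k R by case=> /eqP; rewrite oner_eq0.
have jk : quat_j R <> quat_k R by case=> /eqP; rewrite oner_eq0.
by case: (cov _ Si) (cov _ Sj) (cov _ Sk) => [i1|i2] [j1|j2] [k1|k2];
  solve [left; eauto | right; eauto].
Qed.

Section Cover.
Variables I I1 I2 : set {mpoly (quat R)[n]}.
Hypotheses (qpI : quasi_prime I) (radI : is_radical I).
Hypothesis cover : forall z K,
  common_zero I z K <-> common_zero I1 z K \/ common_zero I2 z K.

(** Quasi primality leaves the alternative that f ^ 2, the symmetrization of f,
    is in I; then f vanishes on the zeros of I and is in I as I is radical. *)
Lemma real_factor f P : I (P * real_mpoly f) -> ~ I (real_mpoly f) ->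
  I P.
Proof.
move=> /qpI [//|]; rewrite symmetrization_real_mpoly => If2 [].
apply: radical_nullstellensatz => // z K [SK IK].
apply/vanishes_at_real => //; apply/eqP.
move/(_ _ If2): IK => /vanishes_at_real - /(_ SK) /eqP.
by rewrite rmorphM mulf_eq0 orbb.
Qed.

Lemma real_mem_iff f : I (real_mpoly f) <->
  forall z K, common_zero I z K -> ceval z f = 0.
Proof.
split=> [If z K [SK IK]|fz]; first exact/(vanishes_at_real _ _ SK)/IK.
by apply: radical_nullstellensatz => // z K zK; apply/vanishes_at_real;
   [case: zK | apply: fz zK].
Qed.

(** P1 * Q^s vanishes at the zeros of I1 through P1. At those of I2 it vanishes
    because Q^s is central, so that the product equals Q * (Q^c * P1). *)
Lemma symmetrization_mem P1 Q : I1 P1 -> ~ I P1 -> I2 Q -> I (symmetrization Q).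
Proof.
move=> I1P1 nIP1 I2Q; rewrite symmetrization_real.
set f := compre _.
have fE : symmetrization Q = real_mpoly f := symmetrization_real Q.
apply: contrapT => nIf; apply: nIP1; apply: (@real_factor f) => //.
apply: radical_nullstellensatz => // z K /cover [] [SK IK].
  exact/vanishes_atM/IK.
by rewrite -real_mpolyC -fE -mulrA; apply/vanishes_atM/IK.
Qed.

End Cover.

(** Some real component of P is nonzero at z, and a real polynomial in I
    vanishes over every zero of I. *)
Lemma escaping_comp I P z K : is_radical I -> common_zero I z K ->
  ~ vanishes_at z K P ->
  exists f, ~ I (real_mpoly f) /\
    forall w, vanishes_on_sphere w P -> ceval w f = 0.
Proof.
move=> radI zK nP; apply: contrapT => nof.
have comp0 f : (forall w, vanishes_on_sphere w P -> ceval w f = 0) -> ceval z f = 0.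
  move=> fP; apply: contrapT => fz; apply: nof; exists f; split=> //.
  by move=> /(real_mem_iff radI) /(_ _ _ zK).
apply/nP/vanishes_on_sphere_at/vanishes_on_sphere_comp.
by split; apply: comp0 => w /vanishes_on_sphere_comp [].
Qed.

(** The core of the proof: for P in I1 the polynomial P f1 f2 vanishes at every
    zero of I, where f1 and f2 are real components of P1 and P2 outside I. *)
Lemma cover_absorbs I I1 I2 P1 P2 z1 z2 K1 K2 :
  right_ideal I1 -> quasi_prime I -> is_radical I ->
  (forall z K, common_zero I z K <-> common_zero I1 z K \/ common_zero I2 z K) ->
  I1 P1 -> common_zero I z2 K2 -> ~ vanishes_at z2 K2 P1 ->
  I2 P2 -> common_zero I z1 K1 -> ~ vanishes_at z1 K1 P2 ->
  I1 `<=` I.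
Proof.
move=> idI1 qpI radI cover I1P1 zK2 nP1 I2P2 zK1 nP2 P I1P.
have cover' z K : common_zero I z K <-> common_zero I2 z K \/ common_zero I1 z K.
  by split=> [/cover|] zK; [tauto|apply/cover; tauto].
have nIP2 : ~ I P2 by move=> /(zK1.2).
have [f1 [nIf1 f1P1]] := escaping_comp radI zK2 nP1.
have [f2 [nIf2 f2P2]] := escaping_comp radI zK1 nP2.
apply: (real_factor qpI radI _ nIf1); apply: (real_factor qpI radI _ nIf2).
have real_mul z K Q f : imag_units K -> ceval z f = 0 ->
    vanishes_at z K (real_mpoly f * Q).
  by move=> SK fz; apply/vanishes_atM/vanishes_at_real.
apply: radical_nullstellensatz => // z K zK.
have [SK IK] := zK.
case/cover: (zK) => [[_ I1K]|zK2'].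
  by rewrite -mulrA; apply/vanishes_atM/I1K.
(* The symmetrizations of I1 are in I, so I1 has a zero on every sphere that
   meets the zero locus of I. *)
have [L zL] : exists L, common_zero I1 z L.
  have [L SL LI1] : exists2 L, imag_units L & forall Q, I1 Q -> vanishes_at z L Q.
    apply: common_zero_on_sphere => // Q I1Q; apply: vanishes_symmetrization.
    have : I (symmetrization Q).
      exact: (symmetrization_mem qpI radI cover' I2P2 nIP2 I1Q).
    rewrite symmetrization_real => /(real_mem_iff radI) /(_ _ _ zK).
    exact: real_vanishes_on_sphere.
  by exists L.
have [<-|LK] := pselect (L = K).
  by rewrite -mulrA; apply/vanishes_atM/(zL.2) => //; case: zL.
(* Two distinct zeros K and L of I on the sphere make it a sphere of zeros, so
   one of I1 and I2 vanishes on all of it, and with it f1 or f2. *)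
have full M : imag_units M -> common_zero I1 z M \/ common_zero I2 z M.
  move=> SM; apply/cover; split=> // Q IQ; apply: vanishes_on_sphere_at.
  have [_ IL] : common_zero I z L by apply/cover; left.
  exact: vanishes_at_two LK (IL _ IQ) (IK _ IQ).
have [/(_ _ I1P1) /f1P1 fz|/(_ _ I2P2) /f2P2 fz] := sphere_pigeonhole full.
  by rewrite -(real_mpolyC f1) -mulrA; apply: real_mul.
by rewrite -real_mpolyC; apply: real_mul.
Qed.

Lemma escaping_point I1 I2 : ~ zero_locus_c I1 `<=` zero_locus_c I2 ->
  exists P z K, [/\ common_zero I1 z K, I2 P & ~ vanishes_at z K P].
Proof.
move=> n12; apply: contrapT => none; apply: n12.
move=> _ /zero_locus_cP [z [K [-> zK]]]; have [SK _] := zK.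
apply/zero_locus_c_point => //; split=> // P I2P.
by apply: contrapT => nP; apply: none; exists P, z, K.
Qed.

End Irreducibility.

Theorem corollary5p18 (R : realType) (n : nat) (I : set {mpoly (quat R)[n]}) :
  right_ideal I ->
  quasi_prime I ->
  is_radical I ->
  quasi_prime (radical (symmetrized_ideal I)) ->
  irreducible (zero_locus_c I).
Proof.
move=> _ qpI radI _ [I1 [I2 [[idI1 _] _ VE n12 n21]]].
have cover z K : common_zero I z K <-> common_zero I1 z K \/ common_zero I2 z K.
  have VP : imag_units K ->
      common_zero I z K <-> common_zero I1 z K \/ common_zero I2 z K.
    move=> SK; rewrite -!zero_locus_c_point // VE; exact: iff_refl.
  by split=> zK; apply/VP => //; move: zK; rewrite /common_zero; tauto.
have [P1 [z2 [K2 [zK2 I1P1 nP1]]]] := escaping_point n21.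
have [P2 [z1 [K1 [zK1 I2P2 nP2]]]] := escaping_point n12.
have IzK2 : common_zero I z2 K2 by apply/cover; right.
have IzK1 : common_zero I z1 K1 by apply/cover; left.
apply/nP1/(IzK2.2).
exact: (cover_absorbs idI1 qpI radI cover I1P1 IzK2 nP1 I2P2 IzK1 nP2 I1P1).
Qed.
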